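(* For all integers $n\ge 3$ and $0\le k\le n-2$, $$P_n^{(k)}(x)=x^{k}\cdot\bigl(P_{n-1}^{(k-1)}(x)+P_{n-1}^{(k)}(x)+\cdots+P_{n-1}^{(n-3)}(x)\bigr)=x^k\sum_{i=k-1}^{n-3}P_{n-1}^{(i)}(x),$$ where $P_{n-1}^{(-1)}(x)=0$ by convention.
   Context: A Dyck path of semilength $n$ is a lattice path from $(0,0)$ to $(2n,0)$ with steps $U=(1,1)$ and $D=(1,-1)$ never going below the $x$-axis. $\mathcal{D}_n$ is the set of Dyck paths of semilength $n$, ordered by $P\le Q$ iff $P$ lies weakly below $Q$; it is a distributive lattice, and the rank of $P\in\mathcal{D}_n$ is $(\alpha(P)-n)/2$, where $\alpha(P)$ is the area of the region between $P$ and the $x$-axis (so the minimum $(UD)^n$ has rank $0$). ECO decomposition: let $n\ge 2$. For $P\in\mathcal{D}_{n-1}$ whose last descent (its final maximal run of $D$ steps) has length $m$, write $P=QD^m$ (so that $Q$ ends with $U$). The sons of $P$ are the $m+1$ Dyck paths $Q\,D^{j}\,UD\,D^{m-j}$, $0\le j\le m$, of semilength $n$ (a peak $UD$ is inserted at each point of the last descent). Each path of $\mathcal{D}_n$ is a son of exactly one path of $\mathcal{D}_{n-1}$, and the sons of a given path form a saturated chain in $\mathcal{D}_n$. The resulting partition of $\mathcal{D}_n$ into saturated chains (one for each element of $\mathcal{D}_{n-1}$) is the ECO decomposition of $\mathcal{D}_n$. For $n\ge 2$ and $0\le k\le n-2$, $P_n^{(k)}(x)$ is the polynomial in which the coefficient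 of $x^i$ is the number of chains of cardinality $k+2$ in the ECO decomposition of $\mathcal{D}_n$ whose minimum has rank $i$. *)

(* Defs.v *)
From HB Require Import structures.
From mathcomp Require Import all_boot all_order all_algebra.
From mathcomp Require Import lra.

Set Implicit Arguments.
Unset Strict Implicit.
Unset Printing Implicit Defensive.

Import Order.TTheory GRing.Theory Num.Theory.
Local Open Scope ring_scope.

Definition up : bool := true.
Definition down : bool := false.

Definition height (w : seq bool) (i : nat) : int :=
  (count_mem up (take i w))%:Z - (count_mem down (take i w))%:Z.

Definition is_dyck (w : seq bool) : bool :=
  [forall i : 'I_(size w).+1, 0 <= height w i] && (height w (size w) == 0).

Record dyck_path (n : nat) := DyckPath {
  dyck_word :> (n.*2).-tuple bool;
  _ : is_dyck dyck_word }.

HB.instance Definition _ n := [isSub for @dyck_word n].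
HB.instance Definition _ n := [Finite of dyck_path n by <:].

Fact dyck_display : Order.disp_t. Proof. exact: Order.Disp tt tt. Qed.

Section DyckOrder.
Variable n : nat.
Implicit Types P Q R : dyck_path n.

Definition below P Q : bool :=
  [forall i : 'I_(n.*2).+1, height P i <= height Q i].

Lemma below_refl : reflexive below.
Proof. by move=> P; apply/forallP. Qed.

Lemma below_trans : transitive below.
Proof.
move=> Q P R /forallP PQ /forallP QR; apply/forallP => i.
exact: le_trans (PQ i) (QR i).
Qed.

Lemma heightS (w : seq bool) i : (i < size w)%N ->
  height w i.+1 = height w i + (if nth down w i then 1 else -1).
Proof.
move=> lti; rewrite /height (take_nth down lti) -cats1 !count_cat /= !addn0.
by case: (nth _ _ _) => /=; rewrite addn0 addn1 -addn1 PoszD ?opprD ?addrA // addrAC.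
Qed.

Lemma below_anti : antisymmetric below.
Proof.
move=> P Q /andP[/forallP PQ /forallP QP].
have eqh i : (i <= n.*2)%N -> height P i = height Q i.
  rewrite -ltnS => lti; apply/eqP.
  by rewrite eq_le (PQ (Ordinal lti)) (QP (Ordinal lti)).
apply/val_inj/val_inj/(@eq_from_nth _ down); rewrite !size_tuple // => i lti.
have := eqh _ lti; rewrite !heightS ?size_tuple // eqh 1?ltnW // => /addrI.
by case: (nth _ _ _); case: (nth _ _ _).
Qed.

HB.instance Definition _ := Order.Le_isPOrder.Build dyck_display
  (dyck_path n) below_refl below_anti below_trans.

(* The region under the path is cut into the unit-width trapezoids lying under
   the successive steps. *)
Definition area P : rat :=
  \sum_(i < n.*2) ((height P i)%:~R + (height P i.+1)%:~R) / 2%:R.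

Definition rank P : rat := (area P - n%:R) / 2%:R.

End DyckOrder.

Definition last_descent (w : seq bool) : nat := find (pred1 up) (rev w).

Definition son_word (w : seq bool) (j : nat) : seq bool :=
  let m := last_descent w in
  take (size w - m) w ++ nseq j down ++ [:: up; down] ++ nseq (m - j) down.

Definition sons n (P : dyck_path n.-1) : {set dyck_path n} :=
  [set R : dyck_path n |
    [exists j : 'I_(last_descent P).+1, tval R == son_word P j]].

Definition eco n : {set {set dyck_path n}} :=
  [set sons P | P : dyck_path n.-1].

Definition is_min n (C : {set dyck_path n}) (P : dyck_path n) : bool :=
  (P \in C) && [forall Q in C, (P <= Q)%O].

Definition eco_count n k i : nat :=
  #|[set C in eco n | (#|C| == k + 2)%N
                      && [exists P, is_min C P && (rank P == i%:R)]]|.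

(* The truncation bound exceeds every rank (see coef_eco_poly). *)
Definition eco_poly n k : {poly int} :=
  \poly_(i < (n ^ 2).*2.+1) (eco_count n k i)%:Z.

Lemma rank_le n (P : dyck_path n) : rank P <= ((n ^ 2).*2)%:R.
Proof.
have hle i : (height P i)%:~R <= (n.*2)%:R :> rat.
  rewrite -[leRHS]/((n.*2)%:Z%:~R) ler_int /height lerBlDr.
  rewrite (le_trans (_ : _ <= (n.*2)%:Z)) ?lerDl // lez_nat.
  apply: leq_trans (count_size _ _) _.
  by rewrite size_take size_tuple; case: ltnP => // /ltnW.
have ale : area P <= \sum_(i < n.*2) (n.*2)%:R.
  apply: ler_sum => i _; have := hle i; have := hle i.+1; lra.
have n0 : 0 <= n%:R :> rat by [].
rewrite sumr_const card_ord -mulrnA in ale.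
have e : (n.*2 * n.*2 = (n ^ 2).*2 * 2)%N by rewrite -!muln2 mulnACA !mulnA mulnn.
by rewrite e natrM in ale; rewrite /rank; lra.
Qed.

Lemma coef_eco_poly n k i : (eco_poly n k)`_i = (eco_count n k i)%:Z.
Proof.
rewrite coef_poly; case: ltnP => // lti; congr Posz; apply/esym/eqP.
rewrite cards_eq0; apply/eqP/setP => C; rewrite !inE.
apply/negP => /and3P[_ _ /existsP[P /andP[_ /eqP e]]].
by have := rank_le P; rewrite e ler_nat leqNgt lti.
Qed.

(* Extension of the upper index by the convention that the polynomial of
   index -1 is 0. *)
Definition eco_polyz n (k : int) : {poly int} :=
  if k is Posz k' then eco_poly n k' else 0.

(* Main.v *)
(** Appending a peak to P gives the minimum of the chain of sons of P, and it has
    the rank of P.  The chain has one more element than the last descent of P has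
    steps, so the coefficients of P_n^(k) count the paths of semilength n - 1 with
    last descent k + 1 by rank.  Every such path is the son of a unique path P'
    of semilength n - 2, and it is then determined by P', whose last descent can
    be any m >= max(k, 1).  Inserting a peak at height h raises the rank by h, here by k.
    Grouping by m = i + 1 yields the sum of the P_(n-1)^(i), and the
    factor x^k. *)
Require Import Defs.
From mathcomp Require Import all_boot all_order all_algebra.
From mathcomp Require Import lra zify.

Set Implicit Arguments.
Unset Strict Implicit.
Unset Printing Implicit Defensive.

Import Order.TTheory GRing.Theory Num.Theory.
Local Open Scope ring_scope.

Implicit Types (a b w : seq bool) (n i k : nat).

(** * Heights under concatenation, and Dyck words *)

Definition final_height w : int := height w (size w).

Lemma height0 w : height w 0 = 0.
Proof. by rewrite /height take0. Qed.

Lemma height_cat a b i : height (a ++ b) i = height a i + height b (i - size a).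
Proof.
have -> : height (a ++ b) i =
    (count_mem up (take i a ++ take (i - size a) b))%:Z
    - (count_mem down (take i a ++ take (i - size a) b))%:Z.
  rewrite /height take_cat; case: ltnP => [ltia | leai].
    (* [i <= size a] is by definition the equation [i - size a == 0], so nothing is taken from
       [b]. *)
    by rewrite (eqP (ltnW ltia)) take0 cats0.
  by rewrite (take_oversize leai).
rewrite /height !count_cat !PoszD; lra.
Qed.

Lemma height_cons x w i :
  height (x :: w) i.+1 = (if x then 1 else -1) + height w i.
Proof. by rewrite /height /=; case: x => /=; lia. Qed.

Lemma height_oversize w i : (size w <= i)%N -> height w i = final_height w.
Proof. by move=> le_wi; rewrite /final_height /height take_size take_oversize. Qed.

Lemma final_height_cat a b :
  final_height (a ++ b) = final_height a + final_height b.
Proof.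
rewrite {1}/final_height height_cat size_cat addKn.
by rewrite height_oversize ?leq_addr.
Qed.

Lemma final_height_cons x w :
  final_height (x :: w) = (if x then 1 else -1) + final_height w.
Proof. exact: height_cons. Qed.

Lemma final_height_nil : final_height [::] = 0.
Proof. exact: height0. Qed.

Lemma final_height_nseq_down r : final_height (nseq r down) = - r%:Z.
Proof.
by elim: r => [|r IHr]; rewrite ?final_height_nil //= final_height_cons IHr /=; lia.
Qed.

(** The starting height [c] is a parameter so that the condition splits over a concatenation; it is
    tested even on the empty word. *)
Fixpoint nonneg_from (c : int) w : bool :=
  (0 <= c) &&
  (if w is x :: w' then nonneg_from (c + (if x then 1 else -1)) w' else true).

Lemma nonneg_fromP c w :
  reflect (forall i, 0 <= c + height w i) (nonneg_from c w).
Proof.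
elim: w c => [|x w IHw] c /=.
  rewrite andbT; apply: (iffP idP) => [c_ge0 i | /(_ 0)]; last first.
    by rewrite height0 addr0.
  by rewrite height_oversize // final_height_nil addr0.
apply: (iffP andP) => [[c_ge0 /IHw nn] [|i] | nn].
- by rewrite height0 addr0.
- by rewrite height_cons addrA.
split; first by have := nn 0; rewrite height0 addr0.
by apply/IHw => i; have := nn i.+1; rewrite height_cons addrA.
Qed.

Lemma is_dyckE w : is_dyck w = nonneg_from 0 w && (final_height w == 0).
Proof.
congr (_ && _); apply/forallP/nonneg_fromP => [nn i | nn i].
  rewrite add0r; case: (leqP i (size w)) => [le_iw | /ltnW le_wi].
    by have := nn (Ordinal (le_iw : (i < (size w).+1)%N)).
  by have := nn ord_max; rewrite (height_oversize le_wi).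
by have := nn i; rewrite add0r.
Qed.

Lemma nonneg_from_cat c a b :
  nonneg_from c (a ++ b) = nonneg_from c a && nonneg_from (c + final_height a) b.
Proof.
elim: a c => [|x a IHa] c /=.
  by rewrite final_height_nil addr0 andbT; case: b => [|y b] /=; case: (0 <= c).
by rewrite final_height_cons addrA IHa andbA.
Qed.

(** The peak only visits the heights [c] and [c + 1], where [c] is the final height of [a]; the
    suffix [b] starts at [c], so [0 <= c] is already imposed. *)
Lemma is_dyck_insert_peak a b :
  is_dyck (a ++ [:: up, down & b]) = is_dyck (a ++ b).
Proof.
rewrite !is_dyckE !nonneg_from_cat !final_height_cat !final_height_cons /=.
congr (_ && _ && _); last by congr (_ == _); lia.
set c := 0 + final_height a; rewrite addrK.
case nn: (nonneg_from c b); rewrite ?andbF // andbT.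
have c_ge0 : 0 <= c by case: b nn => [|x b] /= /andP[].
by rewrite c_ge0 addr_ge0.
Qed.

(** * Effect of inserting or moving a peak on area and order *)

Definition height_sum w : int := \sum_(i < size w) height w i.

Lemma height_sum_cat a b :
  height_sum (a ++ b) =
  height_sum a + final_height a * (size b)%:Z + height_sum b.
Proof.
rewrite /height_sum size_cat big_split_ord /= -addrA; congr (_ + _).
  apply: eq_bigr => i _.
  by rewrite height_cat (eqP (ltnW (ltn_ord i))) height0 addr0.
(* The product becomes a constant sum over the positions of [b], to be matched term by term. *)
rewrite -natz mulr_natr -[X in _ *+ X]card_ord -sumr_const -big_split.
apply: eq_bigr => i _ /=.
by rewrite height_cat addKn height_oversize ?leq_addr.
Qed.

(** Two steps are added, starting at heights [h] and [h + 1] with [h = final_height a]; all other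
    steps keep their heights. *)
Lemma height_sum_insert_peak a b :
  height_sum (a ++ [:: up, down & b]) =
  height_sum (a ++ b) + 2 * final_height a + 1.
Proof.
rewrite -[X in a ++ X]/([:: up; down] ++ b) !height_sum_cat size_cat.
have -> : height_sum [:: up; down] = 1.
  by rewrite /height_sum !big_ord_recl big_ord0.
rewrite !final_height_cons final_height_nil /=; lia.
Qed.

Lemma height_swap a b i :
  height (a ++ [:: down, up & b]) i <= height (a ++ [:: up, down & b]) i.
Proof.
rewrite !height_cat lerD2l.
by case: (i - size a)%N => [|[|m]]; rewrite !(height_cons, height0) // addrCA.
Qed.

(** A peak moves left past one down step by turning a valley into a peak, which only raises the
    path; iterate [r] times. *)
Lemma height_move_peak r w i :
  height (nseq r down ++ [:: up, down & w]) i <=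
  height [:: up, down & nseq r down ++ w] i.
Proof.
elim: r i => [|r IHr] [|i] //.
apply: le_trans _ (height_swap [::] (down :: nseq r down ++ w) i.+1).
by rewrite /= !(height_cons down) lerD2l.
Qed.

(** * Last descent, sons and parents of words *)

Definition core w := take (size w - last_descent w) w.

Lemma last_descent_cat_down w s :
  last_descent (w ++ nseq s down) = (s + last_descent w)%N.
Proof.
by rewrite /last_descent rev_cat rev_nseq find_cat has_nseq /= andbF size_nseq.
Qed.

Lemma last_descent_rcons_up w : last_descent (rcons w up) = 0%N.
Proof. by rewrite /last_descent rev_rcons. Qed.

Lemma core_cat_down w s : core (w ++ nseq s down) = core w.
Proof.
rewrite /core last_descent_cat_down size_cat size_nseq addnC subnDl takel_cat //.
exact: leq_subr.
Qed.

Lemma core_rcons_up w : core (rcons w up) = rcons w up.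
Proof. by rewrite /core last_descent_rcons_up subn0 take_size. Qed.

Lemma coreK w : core w ++ nseq (last_descent w) down = w.
Proof.
elim/last_ind: w => // w [] IHw.
  by rewrite core_rcons_up last_descent_rcons_up cats0.
rewrite -cats1 -[[:: _]]/(nseq 1 down) core_cat_down last_descent_cat_down.
by rewrite addnC nseqD catA IHw.
Qed.

Lemma core_rcons w : up \in w -> exists q, core w = rcons q up.
Proof.
elim/last_ind: w => // w [] IHw; first by exists w; rewrite core_rcons_up.
rewrite mem_rcons inE => /IHw[q eq_q]; exists q.
by rewrite -cats1 -[[:: _]]/(nseq 1 down) core_cat_down.
Qed.

Lemma son_wordE w j :
  son_word w j =
  (core w ++ nseq j down) ++ [:: up, down & nseq (last_descent w - j) down].
Proof. by rewrite /son_word -catA. Qed.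

Lemma son_word_rcons w j :
  son_word w j =
  rcons (core w ++ nseq j down) up ++ nseq (last_descent w - j).+1 down.
Proof. by rewrite son_wordE cat_rcons. Qed.

Lemma last_descent_son w j :
  last_descent (son_word w j) = (last_descent w - j).+1.
Proof. by rewrite son_word_rcons last_descent_cat_down last_descent_rcons_up addn0. Qed.

Lemma core_cat_nseqK w j : (j <= last_descent w)%N ->
  (core w ++ nseq j down) ++ nseq (last_descent w - j) down = w.
Proof. by move=> le_j; rewrite -catA -nseqD subnKC // coreK. Qed.

(** Inverse of peak insertion: the last peak is made of the final [up] of the core and the first
    step of the last descent. *)
Definition parent_word w :=
  take (size (core w)).-1 (core w) ++ nseq (last_descent w).-1 down.

Lemma son_wordK w j : (j <= last_descent w)%N -> parent_word (son_word w j) = w.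
Proof.
move=> le_j; rewrite /parent_word last_descent_son.
rewrite son_word_rcons core_cat_down core_rcons_up size_rcons /=.
by rewrite -cats1 take_size_cat // core_cat_nseqK.
Qed.

(** Deleting the last peak merges the down steps just before it into the last descent; their number
    is the position [j] where the peak goes back. *)
Lemma parent_wordK w : up \in w -> (0 < last_descent w)%N ->
  let j := (last_descent (parent_word w) - (last_descent w).-1)%N in
  son_word (parent_word w) j = w.
Proof.
move=> /core_rcons[q eq_q] ld_gt0.
have -> : parent_word w = q ++ nseq (last_descent w).-1 down.
  by rewrite /parent_word eq_q size_rcons -cats1 take_size_cat.
rewrite last_descent_cat_down addKn /=.
rewrite son_word_rcons core_cat_down coreK last_descent_cat_down addnK.
by rewrite prednK // -eq_q coreK.
Qed.

Lemma is_dyck_son w j :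
  (j <= last_descent w)%N -> is_dyck (son_word w j) = is_dyck w.
Proof. by move=> le_j; rewrite son_wordE is_dyck_insert_peak core_cat_nseqK. Qed.

Lemma size_son_word w j :
  (j <= last_descent w)%N -> size (son_word w j) = (size w).+2.
Proof.
move=> le_j; rewrite -{2}(core_cat_nseqK le_j) son_wordE.
by rewrite !size_cat /= !addnS.
Qed.

(** A final up step ending at height 0 would start at height -1. *)
Lemma last_descent_gt0 w : is_dyck w -> up \in w -> (0 < last_descent w)%N.
Proof.
move=> dyck_w /core_rcons[q eq_q]; rewrite lt0n; apply/eqP => ld0.
move: dyck_w; rewrite -(coreK w) ld0 eq_q cats0 -cats1 is_dyckE.
rewrite nonneg_from_cat final_height_cat final_height_cons final_height_nil /=.
lia.
Qed.

Lemma last_descent_le_count w : (last_descent w <= count_mem down w)%N.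
Proof. by rewrite -{2}(coreK w) count_cat count_nseq /= mul1n leq_addl. Qed.

(** * Step counts and area of a Dyck path *)

Section DyckPaths.
Variable n : nat.
Implicit Types P Q : dyck_path n.

Lemma dyck_pathP P : is_dyck P.
Proof. exact: valP P. Qed.

Lemma dyck_path_inj : injective (fun P => P : seq bool).
Proof. by move=> P Q eqPQ; apply/val_inj/val_inj. Qed.

Lemma final_height_dyck P : final_height P = 0.
Proof. by have := dyck_pathP P; rewrite is_dyckE => /andP[_ /eqP]. Qed.

Lemma count_dyck P : count_mem up P = n /\ count_mem down P = n.
Proof.
have := final_height_dyck P; rewrite /final_height /height take_size.
have := count_predC (pred1 up) P; rewrite size_tuple.
have -> : count (predC (pred1 up)) P = count_mem down P by apply: eq_count; case.
move: (count_mem up P) (count_mem down P) => u d.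
by rewrite -addnn; lia.
Qed.

Lemma last_descent_le P : (last_descent P <= n)%N.
Proof. by have := last_descent_le_count P; rewrite (count_dyck P).2. Qed.

(** Left and right endpoints of the trapezoids have the same total height, by telescoping, since the
    path starts and ends at height 0. *)
Lemma areaE P : area P = (height_sum P)%:~R.
Proof.
rewrite /area -mulr_suml big_split /=.
have -> : \sum_(i < n.*2) (height P i.+1)%:~R
        = \sum_(i < n.*2) (height P i)%:~R :> rat.
  apply/eqP; rewrite -subr_eq0 -sumrB.
  rewrite -(big_mkord xpredT (fun i => (height P i.+1)%:~R - (height P i)%:~R)).
  rewrite telescope_sumr // height0.
  by have := final_height_dyck P; rewrite /final_height size_tuple => ->.
rewrite /height_sum size_tuple rmorph_sum /=; lra.
Qed.

End DyckPaths.

(** * Sons as Dyck paths, and the chains they form *)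

Section Sons.
Variable n : nat.
Implicit Types P Q : dyck_path n.

Lemma size_son P (j : 'I_(last_descent P).+1) : size (son_word P j) == n.+1.*2.
Proof. by rewrite (size_son_word (leq_ord j)) size_tuple doubleS. Qed.

Lemma is_dyck_son_tuple P j : is_dyck (Tuple (@size_son P j)).
Proof. by rewrite /= (is_dyck_son (leq_ord j)) dyck_pathP. Qed.

Definition son P j : dyck_path n.+1 := DyckPath (@is_dyck_son_tuple P j).

Lemma word_son P j : @son P j = son_word P j :> seq bool.
Proof. by []. Qed.

Lemma son_parent_inj P Q j j' : @son P j = @son Q j' -> P = Q.
Proof.
move=> eq_son; apply: dyck_path_inj.
rewrite /= -(son_wordK (leq_ord j)) -(son_wordK (leq_ord j')).
by rewrite -!word_son eq_son.
Qed.

Lemma son_inj P : injective (@son P).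
Proof.
move=> j j' eq_son; apply: val_inj => /=.
have := congr1 (fun R : dyck_path _ => last_descent R) eq_son.
rewrite /= !last_descent_son.
have := ltn_ord j; have := ltn_ord j'; lia.
Qed.

(** The peak sits at height [h = last_descent P - j], the number of down steps still to come. Area
    grows by [2h + 1] and semilength by 1, so the rank grows by [h]. *)
Lemma rank_son P j : rank (@son P j) = rank P + (last_descent P - j)%:R.
Proof.
have le_j := leq_ord j.
have fh : final_height (core P ++ nseq j down) = (last_descent P - j)%:Z.
  have := final_height_dyck P.
  rewrite -{1}(core_cat_nseqK le_j) final_height_cat final_height_nseq_down.
  by move/eqP; rewrite subr_eq0 => /eqP.
have areaS : area (@son P j) = area P + 2 * (last_descent P - j)%:R + 1.
  rewrite !areaE word_son son_wordE height_sum_insert_peak core_cat_nseqK // fh.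
  by rewrite !rmorphD rmorphM.
rewrite /rank areaS -[n.+1%:R]natr1; lra.
Qed.

Lemma son_surj (R : dyck_path n.+1) : exists P j, R = @son P j.
Proof.
have up_R : up \in (R : seq bool).
  by rewrite -has_pred1 has_count (count_dyck R).1.
have ld_gt0 := last_descent_gt0 (dyck_pathP R) up_R.
have eqR := parent_wordK up_R ld_gt0.
set p := parent_word R in eqR; simpl in eqR; set j := (_ - _)%N in eqR.
have le_j : (j <= last_descent p)%N by exact: leq_subr.
have size_p : size p == n.*2.
  by rewrite -2!eqSS -(size_son_word le_j) eqR size_tuple doubleS.
have dyck_p : is_dyck (Tuple size_p) by rewrite /= -(is_dyck_son le_j) eqR dyck_pathP.
exists (DyckPath dyck_p), (Ordinal (le_j : (j < (last_descent p).+1)%N)).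
exact: dyck_path_inj.
Qed.

Lemma in_sonsP P (R : dyck_path n.+1) :
  reflect (exists j, R = @son P j) (R \in @sons n.+1 P).
Proof.
rewrite inE; apply: (iffP existsP) => [[j /eqP eqR] | [j ->]]; exists j => //.
exact: dyck_path_inj.
Qed.

Lemma card_sons P : #|@sons n.+1 P| = (last_descent P).+1.
Proof.
have -> : @sons n.+1 P = @son P @: [set: 'I_(last_descent P).+1].
  apply/setP => R; apply/in_sonsP/imsetP => [[j ->] | [j _ ->]]; by exists j.
by rewrite card_imset ?cardsT ?card_ord //; apply: son_inj.
Qed.

Lemma sons_inj : injective (@sons n.+1).
Proof.
move=> P Q eq_sons.
have : @son P ord0 \in @sons n.+1 P by apply/in_sonsP; exists ord0.
by rewrite eq_sons => /in_sonsP[j /son_parent_inj].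
Qed.

(** [ord_max] puts the peak on the axis. Past the common prefix it remains to compare a peak after
    [last_descent P - j] down steps with one before them. *)
Lemma son_max_le P j : (@son P ord_max <= @son P j)%O.
Proof.
have le_j := leq_ord j.
apply/forallP => i; rewrite !word_son !son_wordE /= subnn.
rewrite -[X in nseq X](subnKC le_j) nseqD -!catA [leRHS]height_cat.
rewrite height_cat lerD2l [leRHS]height_cat height_cat lerD2l.
by rewrite (le_trans (height_move_peak _ _ _)) // cats0.
Qed.

Lemma is_min_sons P R : is_min (@sons n.+1 P) R = (R == @son P ord_max).
Proof.
have in_max : @son P ord_max \in @sons n.+1 P by apply/in_sonsP; exists ord_max.
apply/andP/eqP => [[/in_sonsP[j ->] /forall_inP min_j] | ->].
  by apply/eqP; rewrite eq_le min_j // son_max_le.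
by split=> //; apply/forall_inP => _ /in_sonsP[j ->]; apply: son_max_le.
Qed.

(** * Counting chains by last descent and rank *)

Lemma eco_count_last_descent k i :
  eco_count n.+1 k i =
  #|[set P : dyck_path n | (last_descent P == k.+1) && (rank P == i%:R)]|.
Proof.
rewrite /eco_count -(card_imset _ sons_inj); apply: eq_card => C.
(* The minimum of the chain has its new peak at height 0, hence the rank of the parent. *)
have minP P : [exists R, is_min (@sons n.+1 P) R && (rank R == i%:R)]
            = (rank P == i%:R).
  apply/existsP/eqP => [[R /andP[]] | rkP].
    by rewrite is_min_sons => /eqP-> /eqP; rewrite rank_son subnn addr0.
  by exists (@son P ord_max); rewrite is_min_sons eqxx rank_son subnn addr0 rkP /=.
rewrite inE; apply/and3P/imsetP => [[/imsetP[P _ ->]] | [P]].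
  rewrite card_sons minP addn2 eqSS => ldP rkP.
  by exists P; rewrite // inE ldP.
rewrite inE => /andP[/eqP ldP rkP] ->; split; first exact: imset_f.
  by rewrite card_sons ldP addn2.
by rewrite minP.
Qed.

Lemma card_last_descentS k i :
  #|[set R : dyck_path n.+1 | (last_descent R == k.+1) && (rank R == i%:R)]| =
  #|[set P : dyck_path n | (k <= last_descent P)%N && (rank P + k%:R == i%:R)]|.
Proof.
(* This insertion point leaves [k] down steps after the new peak when [k <= last_descent P].
   Injectivity holds for all [P], since a son determines its parent. *)
pose f P := @son P (inord (last_descent P - k)).
have f_inj : injective f by move=> P Q /son_parent_inj.
rewrite -(card_imset _ f_inj); apply: eq_card => R.
rewrite inE; apply/andP/imsetP => [[/eqP ldR rkR] | [P]].
  have [P [j eqR]] := son_surj R.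
  have le_j := leq_ord j.
  move: ldR rkR; rewrite eqR word_son last_descent_son rank_son => -[ldP] rkP.
  exists P; first by rewrite inE -ldP leq_subr.
  by congr son; apply: val_inj; rewrite /= inordK -ldP ?subKn // ltnS.
rewrite inE => /andP[le_k rkP] ->.
rewrite word_son last_descent_son rank_son inordK ?ltnS ?leq_subr //.
by rewrite subKn.
Qed.

End Sons.

Lemma rank_ge0 n (P : dyck_path n) : 0 <= rank P.
Proof.
elim: n P => [|n IHn] P; first by rewrite /rank /area big_ord0 subrr mul0r.
(* Every path grows from the empty one by peak insertions, each raising the rank by a natural
   number. *)
by have [Q [j ->]] := son_surj P; rewrite rank_son addr_ge0.
Qed.

Lemma card_last_descent_ge n k i : (k <= i)%N ->
  #|[set P : dyck_path n | (k <= last_descent P)%N && (rank P + k%:R == i%:R)]| =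
  (\sum_(k <= j < n.+1)
    #|[set P : dyck_path n | (last_descent P == j) && (rank P == (i - k)%:R)]|)%N.
Proof.
move=> le_ki; rewrite -sum1dep_card big_mkcond /=.
under [RHS]eq_bigr => j _ do rewrite -sum1dep_card big_mkcond /=.
(* With the sums exchanged, a path contributes only at [j = last_descent P], which is at most
   [n]. *)
rewrite exchange_big /=; apply: eq_bigr => P _.
rewrite natrB // eq_sym -subr_eq eq_sym.
case: (rank P == _); last by rewrite andbF big1 // => j _; rewrite andbF.
under [RHS]eq_bigr => j _ do rewrite andbT eq_sym.
by rewrite -big_mkcond big_nat1_eq ltnS last_descent_le !andbT.
Qed.

(** At [j = 0] the zero polynomial of index -1 is the right value: a path of positive semilength is
    a son, so its last descent is positive. *)
Lemma coef_eco_polyz n j i :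
  (eco_polyz n.+2 (j%:Z - 1))`_i =
  #|[set P : dyck_path n.+1 | (last_descent P == j) && (rank P == i%:R)]|%:Z.
Proof.
case: j => [|j]; last first.
  by rewrite subzSS subr0 coef_eco_poly eco_count_last_descent.
rewrite coef0 eq_card0 // => P; rewrite inE.
have [Q [j ->]] := son_surj P.
by rewrite word_son last_descent_son.
Qed.

Theorem proposition3p3 (n k : nat) (hn : (3 <= n)%N) (hk : (k <= n - 2)%N) :
  eco_poly n k =
  'X^k * \sum_(k <= j < n - 1) eco_polyz (n - 1) (j%:Z - 1).
Proof.
case: n hn {hk} => [|[|[|n]]] // _; rewrite subSS subn0.
apply/polyP => i; rewrite coef_eco_poly coefXnM.
(* Two passages to parents: from chains in semilength [n.+3] to paths of semilength [n.+2], then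
   [n.+1]. *)
rewrite eco_count_last_descent card_last_descentS.
case: ltnP => [lt_ik | le_ki]; last first.
  rewrite card_last_descent_ge // coef_sum -[LHS]natz natr_sum.
  by apply: eq_bigr => j _; rewrite coef_eco_polyz natz.
(* Below degree [k], a counted path would have the negative rank [i - k]. *)
rewrite eq_card0 // => P; rewrite inE; apply/negP => /andP[_ /eqP eq_i].
have := rank_ge0 P; move: lt_ik; rewrite -(ltr_nat rat) -eq_i; lra.
Qed.
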